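(* Let $R,R'$ be finite rings and let $\Phi\colon R\to R'$ be an infinitesimal extension; namely, $\Phi$ is a surjective ring homomorphism and the kernel of $\Phi$ is a nilpotent ideal. If $R'$ has the $2$-sum property, then so does $R$.
   Context: Rings are finite, unital, with $0\neq 1$, not necessarily commutative; ring homomorphisms preserve $1$. A ring $R$ has the $n$-sum property if every element of $R$ can be written as the sum of exactly $n$ elements of the unit group $R^\times$. *)

(* Defs.v *)
From mathcomp Require Import all_boot all_order all_fingroup all_algebra.

Set Implicit Arguments.
Unset Strict Implicit.
Unset Printing Implicit Defensive.

Import GRing.Theory.
Local Open Scope ring_scope.

(* Finite, possibly noncommutative unital rings with 0 != 1 are rendered as
   [finUnitRingType]. No generality is lost: its unit predicate is axiomatized
   to be two-sided invertibility, which is decidable in a finite ring. *)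

Definition sum_property (n : nat) (R : finUnitRingType) : Prop :=
  forall x : R, exists u : 'I_n -> R,
    (forall i, u i \is a GRing.unit) /\ x = \sum_(i < n) u i.

(* The finite group structure of [R] is the one of [+%R], so that [<<A>>] is the
   additive subgroup generated by [A]: I J consists of the finite sums of
   products x * y with x in I and y in J. The inner [%R] is needed: under [%g],
   [*] would denote the additive group law. *)
Definition ideal_mul (R : finUnitRingType) (I J : {set R}) : {set R} :=
  <<[set (x * y)%R | x in I, y in J]>>%g.

Definition ideal_exp (R : finUnitRingType) (I : {set R}) (k : nat) : {set R} :=
  iter k (ideal_mul I) [set: R].

Definition nilpotent_ideal (R : finUnitRingType) (I : {set R}) : Prop :=
  exists k : nat, ideal_exp I k = [set 0].

Definition ring_ker (R R' : finUnitRingType) (f : {rmorphism R -> R'}) :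
  {set R} := [set x | f x == 0].

Definition infinitesimal_extension (R R' : finUnitRingType)
    (f : {rmorphism R -> R'}) : Prop :=
  (forall y : R', exists x : R, f x = y) /\ nilpotent_ideal (ring_ker f).

(* Main.v *)
Require Import Defs.
From mathcomp Require Import all_boot all_order all_fingroup all_algebra.

(** The unit groups see everything modulo a nilpotent kernel: an element of [R]
    is a unit as soon as its image in [R'] is ([unit_lift]).  Indeed, if [y]
    lifts the inverse of the image of [x], then [x * y] and [y * x] have the form
    [1 - z] with [z] in the kernel; such a [z] is nilpotent ([ring_ker_nilp]), so
    [1 - z] is inverted by a finite geometric series ([unitr_1B_nilp]), and [x]
    is invertible on both sides.

    Now write the image of [x] as a sum of two units and lift the first one
    arbitrarily to some [v].  Then [x - v] lifts the second one, and both [v] and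
    [x - v] are units because their images are. *)

Set Implicit Arguments.
Unset Strict Implicit.
Unset Printing Implicit Defensive.

Import GRing.Theory.
Local Open Scope ring_scope.

(** The geometric series of [z] stops at degree [k], and telescopes against
    [1 - z]; being a polynomial in [z], it is an inverse on both sides. *)
Lemma unitr_1B_nilp (R : unitRingType) (z : R) (k : nat) :
  z ^+ k = 0 -> 1 - z \is a GRing.unit.
Proof.
move=> zk0; set S := \sum_(i < k) z ^+ i.
have SC : S * (1 - z) = (1 - z) * S.
  apply: commrB; first exact: commr1.
  by apply/commr_sym/commr_sum => i _; apply: commrX.
have S1 : (1 - z) * S = 1.
  by apply: oppr_inj; rewrite -mulNr opprB -subrX1 zk0 sub0r.
by apply/unitrP; exists S; rewrite SC S1.
Qed.

Lemma unitr_lr_inv (R : unitRingType) (x l r : R) :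
  l * x = 1 -> x * r = 1 -> x \is a GRing.unit.
Proof.
move=> lx1 xr1; apply/unitrP; exists l; split=> //.
by rewrite -[l]mulr1 -xr1 (mulrA l) lx1 mul1r.
Qed.

(** Bridges nilpotency of an ideal and nilpotency of its elements: a power of [z]
    is one of the generating products of the corresponding ideal power. *)
Lemma ideal_exp_expr (R : finUnitRingType) (I : {set R}) (z : R) (k : nat) :
  z \in I -> z ^+ k \in ideal_exp I k.
Proof.
move=> zI; elim: k => [|k IHk]; first by rewrite inE.
by rewrite exprS; apply: mem_gen; apply: imset2_f.
Qed.

Lemma ring_ker_nilp (R R' : finUnitRingType) (f : {rmorphism R -> R'}) (z : R) :
  nilpotent_ideal (ring_ker f) -> f z = 0 -> exists k : nat, z ^+ k = 0.
Proof.
move=> [k Ik0] fz0; exists k; apply/set1P; rewrite -Ik0.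
by apply: ideal_exp_expr; rewrite inE fz0.
Qed.

(** Noncommutativity makes both products [x * y] and [y * x] necessary: each one
    provides an inverse of [x] on one side. *)
Lemma unit_lift (R R' : finUnitRingType) (f : {rmorphism R -> R'}) (x : R) :
  infinitesimal_extension f -> f x \is a GRing.unit -> x \is a GRing.unit.
Proof.
move=> [f_surj nilI] Ufx.
have unit_over1 w : f w = 1 -> w \is a GRing.unit.
  move=> fw1; have fz0 : f (1 - w) = 0 by rewrite rmorphB rmorph1 fw1 subrr.
  have [k zk0] := ring_ker_nilp nilI fz0.
  by have := unitr_1B_nilp zk0; rewrite subKr.
have [y fy] := f_surj (f x)^-1.
have Uxy : x * y \is a GRing.unit by apply: unit_over1; rewrite rmorphM fy divrr.
have Uyx : y * x \is a GRing.unit by apply: unit_over1; rewrite rmorphM fy mulVr.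
apply: (@unitr_lr_inv _ x ((y * x)^-1 * y) (y * (x * y)^-1)).
  by rewrite -mulrA mulVr.
by rewrite mulrA divrr.
Qed.

Theorem proposition2p8 (R R' : finUnitRingType) (Phi : {rmorphism R -> R'}) :
  infinitesimal_extension Phi -> sum_property 2 R' -> sum_property 2 R.
Proof.
move=> Phi_inf sumR' x.
have [u [Uu]] := sumR' (Phi x); rewrite big_ord_recl big_ord1 => fx.
have [v fv] := Phi_inf.1 (u ord0).
exists (fun i : 'I_2 => if i == ord0 then v else x - v); split; last first.
  by rewrite big_ord_recl big_ord1 /= addrC subrK.
move=> i; apply: (unit_lift Phi_inf).
case: ifP => _; first by rewrite fv.
by rewrite rmorphB fv fx addrC addKr.
Qed.
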